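(* Let $n\ge 2$ be an integer, let $A_1A_2\ldots A_{n+1}$ be a (non-degenerate) $n$-simplex in $\mathbb{R}^n$, let $M$ be a point in its interior, and let $N_1N_2\ldots N_{n+1}$ be the cevian simplex corresponding to $M$. Put $$\omega_n=\frac{n^{2}-\sqrt{n^{4}-4n^{2}+4n}}{2n}.$$ Then $$\frac{[N_1N_2\ldots N_{n}N_{n+1}]-[MN_1N_2\ldots N_{n}]}{[A_1A_2\ldots A_{n+1}]}\le\frac{(n-1)^{n-1}(1-n\omega_n)}{(n^{2}-n+1-n\omega_n)^{n-1}},$$ and equality holds when $M$ has barycentric coordinates $(\omega_n,\omega_n,\ldots,\omega_n,1-n\omega_n)$, in this order, with respect to $A_1A_2\ldots A_{n+1}$.
   Context: $[X_1X_2\ldots X_{n+1}]$ denotes the ($n$-dimensional, nonnegative) volume of the $n$-simplex with vertices $X_1,\ldots,X_{n+1}$. For an interior point $M$ of the simplex $A_1A_2\ldots A_{n+1}$, the point $N_i$ ($i=1,\ldots,n+1$) is the foot of the cevian from $A_i$ through $M$, i.e. the intersection of the line $A_iM$ with the facet opposite to $A_i$ (the facet spanned by the vertices $A_j$, $j\ne i$); the cevian simplex corresponding to $M$ is the simplex $N_1N_2\ldots N_{n+1}$. The barycentric coordinates $(\lambda_1,\ldots,\lambda_{n+1})$ of $M$ with respect to $A_1A_2\ldots A_{n+1}$ are normalized: $M=\sum_{i=1}^{n+1}\lambda_iA_i$ with $\sum_{i=1}^{n+1}\lambda_i=1$. *)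

(* Defs.v *)
From mathcomp Require Import all_boot all_order all_algebra.
From mathcomp Require Import all_classical all_reals all_analysis.

Set Implicit Arguments.
Unset Strict Implicit.
Unset Printing Implicit Defensive.

Import Order.TTheory GRing.Theory Num.Theory.
Import numFieldNormedType.Exports.

Local Open Scope classical_set_scope.
Local Open Scope ring_scope.

(* Points of the n-dimensional real space are row vectors; a list of k points
   X_1, ..., X_k is a function on 'I_k, so X_i is indexed by i - 1. *)

(* n-dimensional Lebesgue measure, as the n-fold product of the Lebesgue
   measure on the real line (the point mass when n = 0). *)
Fixpoint lebesgue_tuple (R : realType) (n : nat) :
    set (n.-tuple (measurableTypeR R)) -> \bar R :=
  match n with
  | 0 => \d_([tuple] : 0.-tuple (measurableTypeR R))
  | m.+1 =>
      pushforward (lebesgue_measure \x lebesgue_tuple (n := m))%E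
        (fun p : measurableTypeR R * m.-tuple (measurableTypeR R) =>
           [tuple of p.1 :: p.2])
  end.

Definition lebesgue_rV (R : realType) (n : nat) (S : set 'rV[R]_n) : \bar R :=
  lebesgue_tuple
    [set t : n.-tuple (measurableTypeR R) | S (\row_i (tnth t i : R))].

Definition convex_hull (R : realType) (n k : nat) (X : 'I_k -> 'rV[R]_n) :
    set 'rV[R]_n :=
  [set P | exists w : 'I_k -> R, [/\ forall i, 0 <= w i,
     \sum_i w i = 1 & P = \sum_i w i *: X i]].

(* The hull is bounded, so that its measure is finite and fine loses
   nothing. *)
Definition volume (R : realType) (n : nat) (X : 'I_n.+1 -> 'rV[R]_n) : R :=
  fine (lebesgue_rV (convex_hull X)).

Definition affinely_independent (R : realType) (n k : nat)
    (X : 'I_k -> 'rV[R]_n) : Prop :=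
  forall w : 'I_k -> R,
    \sum_i w i = 0 -> \sum_i w i *: X i = 0 -> forall i, w i = 0.

Definition line (R : realType) (n : nat) (P Q : 'rV[R]_n) : set 'rV[R]_n :=
  [set P + t *: (Q - P) | t in [set: R]].

Definition facet (R : realType) (n : nat) (A : 'I_n.+1 -> 'rV[R]_n)
    (i : 'I_n.+1) : set 'rV[R]_n :=
  convex_hull (fun j : 'I_n => A (lift i j)).

Definition cevian_simplex (R : realType) (n : nat) (A : 'I_n.+1 -> 'rV[R]_n)
    (M : 'rV[R]_n) (N : 'I_n.+1 -> 'rV[R]_n) : Prop :=
  forall i, (line (A i) M `&` facet A i) (N i).

(* The list M, N_1, ..., N_n, that is, M followed by all N_i but the last. *)
Definition cons_init (R : realType) (n : nat) (M : 'rV[R]_n)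
    (N : 'I_n.+1 -> 'rV[R]_n) (i : 'I_n.+1) : 'rV[R]_n :=
  if unlift ord0 i is Some j then N (widen_ord (leqnSn n) j) else M.

Definition barycentric_coords (R : realType) (n : nat)
    (A : 'I_n.+1 -> 'rV[R]_n) (M : 'rV[R]_n) (l : 'I_n.+1 -> R) : Prop :=
  \sum_i l i = 1 /\ M = \sum_i l i *: A i.

Definition omega (R : realType) (n : nat) : R :=
  (n%:R ^+ 2 - Num.sqrt (n%:R ^+ 4 - 4 * n%:R ^+ 2 + 4 * n%:R)) / (2 * n%:R).

(* Main.v *)
From HB Require Import structures.
Require Import Defs.
From mathcomp Require Import all_boot all_order all_algebra.
From mathcomp Require Import all_classical all_reals all_analysis.
From mathcomp Require Import measurable_realfun ring lra.
Import Order.TTheory GRing.Theory Num.Theory.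
Import numFieldNormedType.Exports.
Local Open Scope classical_set_scope.
Local Open Scope ring_scope.

Set Implicit Arguments.
Unset Strict Implicit.
Unset Printing Implicit Defensive.

(** Write l_i for the barycentric coordinates of M; they are all positive
because M is interior.  The foot N_i lies on a line through A_i and in the facet
l_i = 0, which forces its coordinates to be l_j / (1 - l_i) for j != i.

Volumes reduce to determinants: if the points X_i are the affine combinations of
the A_j with coefficient matrix B, then [X] = |det B| [A] ([volume_comb]).  This
is the change of variables formula for Lebesgue measure under an invertible
affine map ([lebesgue_rV_affine]), applied to the map that carries a fixed
reference simplex to the simplex X.  For N the matrix is, up to diagonal
factors, the all-ones matrix minus the identity, with determinant n up to sign;
for M, N_1, ..., N_n it is, up to diagonal factors, unimodular.  With t the last
coordinate of M, the ratio to be bounded is therefore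
(prod_i l_i / (1 - l_i)) (n - 1 + t) ([cevian_volume_ratio]).

At fixed t the product of the odds x / (1 - x) of the other n coordinates, whose
sum 1 - t is less than 1, is largest when they are all equal
([prod_odds_le]): replacing a pair x <= a <= y by the pair a, x + y - a, where a
is the mean, keeps the sum and increases the product.  What remains is
t ((1 - t) / (n - 1 + t))^(n - 1).  Its logarithmic derivative vanishes at the
root of n (n - 1) t = (1 - t) (n - 1 + t) in (0, 1), which is 1 - n omega_n, and
Bernoulli's inequality shows that this is the maximum ([one_var_max]).  In the
case of equality both steps are equalities. *)

(** * Lebesgue measure under affine maps *)

Section LebesgueRV.
Variable R : realType.
Local Notation mR := (measurableTypeR R).

Lemma measurable_uncons n : measurable_fun [set: n.+1.-tuple mR]
  (fun t : n.+1.-tuple mR => (thead t, [tuple of behead t])).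
Proof.
apply/measurable_fun_pairP; split.
  exact: (@measurable_tnth _ mR n.+1 ord0).
exact: measurable_behead.
Qed.

Lemma measurable_tcons n : measurable_fun [set: mR * n.-tuple mR]
  (fun p : mR * n.-tuple mR => [tuple of p.1 :: p.2]).
Proof. exact: measurable_cons. Qed.

(** The recursive definition only yields a set function.  Tonelli's theorem needs
it to be a sigma-finite measure; both properties pass from a product to its image
under the bimeasurable bijection that conses a coordinate to a tuple. *)
Lemma lebesgue_tuple_measure n :
  exists mu : {sigma_finite_measure set (n.-tuple mR) -> \bar R},
    lebesgue_tuple (n := n) = mu.
Proof.
elim: n => [|n [mu muE]] /=.
  by exists (\d_([tuple] : 0.-tuple mR)).
rewrite muE.
pose f := fun p : mR * n.-tuple mR => [tuple of p.1 :: p.2].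
have mf : measurable_fun [set: mR * n.-tuple mR] f by exact: measurable_tcons.
pose g := fun t : n.+1.-tuple mR => (thead t, [tuple of behead t]).
have mg : measurable_fun [set: n.+1.-tuple mR] g by exact: measurable_uncons.
have gK p : g (f p) = p.
  by case: p => x t; congr pair; apply/val_inj.
have gfK (X : set _) : f @^-1` (g @^-1` X) = X.
  by apply/seteqP; split => p; rewrite /preimage /mkset gK.
pose prod : {measure set (mR * n.-tuple mR)%type -> \bar R} :=
  (@lebesgue_measure R \x mu)%E.
pose nu : {measure set (n.+1.-tuple mR) -> \bar R} :=
  measure_function_pushforward__canonical__measure_function_Measure prod mf.
have sf : sigma_finite setT nu.
  have /sigma_finiteP[F [FT ndF Foo]] := sigma_finiteT (@lebesgue_measure R).
  have /sigma_finiteP[G [GT ndG Goo]] := sigma_finiteT mu.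
  exists (fun k => g @^-1` (F k `*` G k)).
    rewrite -preimage_bigcup; apply/esym; rewrite -subTset => t _.
    have [i _ Fi] : (\bigcup_i F i) (g t).1 by rewrite -FT.
    have [j _ Gj] : (\bigcup_j G j) (g t).2 by rewrite -GT.
    exists (maxn i j) => //; split.
      by move: Fi; exact/subsetPset/ndF/leq_maxl.
    by move: Gj; exact/subsetPset/ndG/leq_maxr.
  move=> k; have [mF Fk] := Foo k; have [mG Gk] := Goo k.
  have mFG : measurable (F k `*` G k) by exact: measurableX.
  split; first by rewrite -[X in measurable X]setTI; exact: mg.
  rewrite /nu /= /pushforward gfK.
  by rewrite /= product_measure1E// lte_mul_pinfty// ge0_fin_numE.
pose sm := Measure_isSigmaFinite.Build _ _ _ nu sf.
pose nu' : {sigma_finite_measure set (n.+1.-tuple mR) -> \bar R} :=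
  HB.pack (Measure.sort nu) sm.
by exists nu'.
Qed.

Definition measurable_rV n (S : set 'rV[R]_n) :=
  measurable [set t : n.-tuple mR | S (\row_i (tnth t i : R))].

Lemma row_tcons n (x : mR) (t : n.-tuple mR) :
  \row_i (tnth [tuple of x :: t] i : R) =
  row_mx (x : R)%:M (\row_i (tnth t i : R)) :> 'rV[R]_(1 + n).
Proof.
apply/rowP => i; rewrite -[i]splitK; case: (fintype.split i) => j /=.
  by rewrite row_mxEl ord1 !mxE eqxx mulr1n (tnth_nth x).
by rewrite row_mxEr !mxE !(tnth_nth x).
Qed.

Lemma lebesgue_rV_sections n (S : set 'rV[R]_(1 + n)) :
  lebesgue_rV S =
  (\int[@lebesgue_measure R]_x lebesgue_rV [set v | S (row_mx (x : R)%:M v)])%E.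
Proof.
rewrite /lebesgue_rV /= /pushforward /product_measure1.
apply: eq_integral => x _; congr (lebesgue_tuple _).
by apply/seteqP; split => t; rewrite xsectionE /mkset /preimage /= ?row_tcons.
Qed.

Lemma measurable_rV_pair n (S : set 'rV[R]_(1 + n)) : measurable_rV S ->
  measurable [set p : mR * n.-tuple mR |
               S (row_mx (p.1 : R)%:M (\row_i (tnth p.2 i : R)))].
Proof.
move=> mS; have := @measurable_tcons n measurableT _ mS.
rewrite setTI; congr measurable.
by apply/seteqP; split => p; rewrite /preimage /mkset row_tcons.
Qed.

Lemma measurable_rV_section n (S : set 'rV[R]_(1 + n)) (x : R) :
  measurable_rV S -> measurable_rV [set v | S (row_mx x%:M v)].
Proof.
move=> /measurable_rV_pair/(measurable_xsection (x : mR)).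
by rewrite xsectionE.
Qed.

Lemma measurable_lebesgue_rV_section n (S : set 'rV[R]_(1 + n)) :
  measurable_rV S ->
  measurable_fun [set: mR]
    ((fun x : mR => lebesgue_rV [set v | S (row_mx (x : R)%:M v)]) : mR -> \bar R).
Proof.
move=> /measurable_rV_pair mS.
have [mu muE] := lebesgue_tuple_measure n.
have := measurable_fun_xsection mu mS.
congr measurable_fun; apply/funext => x /=.
by rewrite xsectionE /lebesgue_rV muE.
Qed.

Lemma lebesgue_rV_ge0 n (S : set 'rV[R]_n) : (0 <= lebesgue_rV S)%E.
Proof.
by rewrite /lebesgue_rV; have [mu ->] := lebesgue_tuple_measure n.
Qed.

(** Tonelli: the section may also be taken in the first coordinate, with the
others fixed.  In this order a transvection that changes only the first
coordinate becomes a translation of the line. *)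
Lemma lebesgue_rV_ysections n (S : set 'rV[R]_(1 + n)) :
  measurable_rV S ->
  lebesgue_rV S =
  (\int[@lebesgue_tuple R n]_t
     @lebesgue_measure R [set x : mR | S (row_mx (x : R)%:M (\row_i (tnth t i : R)))])%E.
Proof.
move=> /measurable_rV_pair mS.
have [mu muE] := lebesgue_tuple_measure n; rewrite muE.
pose pm2 : {measure set (mR * n.-tuple mR)%type -> \bar R} :=
  (@lebesgue_measure R \x^ mu)%E.
transitivity ((@lebesgue_measure R \x mu)%E [set p : mR * n.-tuple mR |
               S (row_mx (p.1 : R)%:M (\row_i (tnth p.2 i : R)))]).
  rewrite lebesgue_rV_sections; apply: eq_integral => x _ /=.
  by rewrite xsectionE /lebesgue_rV muE.
rewrite (@product_measure_unique _ _ _ _ _ _ _ pm2)//.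
  by apply: eq_integral => t _ /=; rewrite ysectionE.
by move=> A B mA mB; exact: (product_measure2E (@lebesgue_measure R) mu).
Qed.

Lemma measurable_rV_affine m n (L : 'M[R]_(m, n)) (c : 'rV[R]_n) (S : set 'rV[R]_n) :
  measurable_rV S -> measurable_rV [set v | S (v *m L + c)].
Proof.
pose f := fun t : m.-tuple mR =>
  [tuple ((\row_i (tnth t i : R)) *m L + c) 0 i | i < n] : n.-tuple mR.
have mf : measurable_fun [set: m.-tuple mR] f.
  apply/measurable_fun_tnthP => i; rewrite /comp.
  under eq_fun do rewrite tnth_mktuple mxE mxE.
  apply: measurable_funD => //; apply: measurable_sum => j.
  under eq_fun do rewrite mxE.
  apply: measurable_funM => //; exact: measurable_tnth.
have fE t : \row_i (tnth (f t) i : R) = (\row_i (tnth t i : R)) *m L + c.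
  by apply/rowP => i; rewrite mxE tnth_mktuple.
move=> /(mf measurableT); rewrite setTI; congr measurable.
by apply/seteqP; split => t; rewrite /preimage /mkset fE.
Qed.

Lemma measurable_affine (a c : R) :
  measurable_fun [set: mR] (fun x : mR => (x : R) * a + c : mR).
Proof. by apply: measurable_funD => //; apply: measurable_funM. Qed.

(** The two sides are measures in A that agree on half-open intervals; the image
interval is half-open on the other side when a < 0. *)
Lemma lebesgue_measure_affine (a c : R) (A : set mR) : a != 0 -> measurable A ->
  (`|a|%:E * @lebesgue_measure R [set x : mR | A ((x : R) * a + c)%R] =
   @lebesgue_measure R A)%E.
Proof.
move=> a0 mA.
pose nu : {measure set mR -> \bar R} :=
  measure_function_pushforward__canonical__measure_function_Measure
    (@lebesgue_measure R) (measurable_affine a c).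
pose nu' : {measure set mR -> \bar R} := mscale (NngNum (normr_ge0 a)) nu.
apply/esym; apply: (@lebesgue_measure_unique R nu') => // _ [[p q]] _ <-.
rewrite /nu' /= /mscale /nu /= /pushforward.
have -> : (fun x : mR => (x : R) * a + c : mR) @^-1` `]p, q]%classic =
    [set` if 0 < a then `](p - c) / a, (q - c) / a]
          else `[(q - c) / a, (p - c) / a[ ].
  apply/seteqP; split => x; case: ltgtP a0 => // a0 _;
    rewrite /preimage /= !in_itv /=.
  - by rewrite ltr_pdivrMr// ler_pdivlMr// ltrBlDr lerBrDr.
  - by rewrite ltr_ndivlMr// ler_ndivrMr// ltrBlDr lerBrDr andbC.
  - by rewrite ltr_pdivrMr// ler_pdivlMr// ltrBlDr lerBrDr.
  - by rewrite ltr_ndivlMr// ler_ndivrMr// ltrBlDr lerBrDr andbC.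
apply/esym; case: ltgtP a0 => // a0 _; rewrite !lebesgue_measure_itv /= !lte_fin.
  rewrite ltr_pM2r ?invr_gt0// ltrD2r gtr0_norm//; case: ifP => _; rewrite ?mule0//.
  rewrite -!EFinB -EFinM; congr (_%:E).
  by rewrite -mulrBl mulrC divfK ?gt_eqF// opprB addrA subrK.
rewrite ltr_nM2r ?invr_lt0// ltrD2r ltr0_norm//; case: ifP => _; rewrite ?mule0//.
rewrite -!EFinB -EFinM; congr (_%:E).
by rewrite -mulrBl mulrC mulrN divfK ?lt_eqF// -opprB opprK !opprB addrA subrK.
Qed.

Lemma integral_affine (a c : R) (g : mR -> \bar R) : a != 0 ->
  measurable_fun [set: mR] g -> (forall x, 0 <= g x)%E ->
  (`|a|%:E * \int[@lebesgue_measure R]_x g ((x : R) * a + c)%R =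
   \int[@lebesgue_measure R]_x g x)%E.
Proof.
move=> a0 mg g0.
pose nu : {measure set mR -> \bar R} :=
  measure_function_pushforward__canonical__measure_function_Measure
    (@lebesgue_measure R) (measurable_affine a c).
pose nu' : {measure set mR -> \bar R} := mscale (NngNum (normr_ge0 a)) nu.
transitivity (\int[nu']_x g x)%E.
  rewrite ge0_integral_mscale//; congr (_ * _)%E.
  by rewrite (ge0_integral_pushforward (measurable_affine a c)).
by apply: eq_measure_integral => A mA _; exact: lebesgue_measure_affine.
Qed.

(** With the last n coordinates fixed, the map translates the first one. *)
Lemma lebesgue_rV_transvection n (d : 'cV[R]_n) (S : set 'rV[R]_(1 + n)) :
  measurable_rV S ->
  lebesgue_rV [set v | S (v *m block_mx 1%:M 0 d 1%:M)] = lebesgue_rV S.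
Proof.
move=> mS; rewrite !lebesgue_rV_ysections//; last first.
  have := measurable_rV_affine (block_mx 1%:M 0 d 1%:M) 0 mS.
  by congr measurable_rV; apply/seteqP; split => v; rewrite /mkset addr0.
have [mu ->] := lebesgue_tuple_measure n.
apply: eq_integral => t _; set u := \row_i _.
pose A := [set x : mR | S (row_mx (x : R)%:M u)].
have mA : measurable A.
  have := measurable_ysection t (measurable_rV_pair mS).
  by rewrite ysectionE.
rewrite -(lebesgue_measure_affine ((u *m d) 0 0) (oner_neq0 R) mA) normr1 mul1e.
congr (lebesgue_measure _); apply/seteqP.
have E (x : R) : row_mx x%:M u *m block_mx 1%:M 0 d 1%:M =
    row_mx (x * 1 + (u *m d) 0 0)%:M u.
  rewrite mul_row_block !mulmx1 mulmx0 add0r mulr1 raddfD /=.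
  by rewrite -mx11_scalar.
by split => x; rewrite /A /mkset E.
Qed.

(** Change of variables in terms of preimages, whose measurability is immediate.
The translation part c is carried along because slicing produces it, even from a
linear map. *)
Definition scales_lebesgue n (L : 'M[R]_n) :=
  forall (c : 'rV[R]_n) (S : set 'rV[R]_n), measurable_rV S ->
  (`|\det L|%:E * lebesgue_rV [set v | S (v *m L + c)%R] = lebesgue_rV S)%E.

Lemma scales_lebesgueM n (K L : 'M[R]_n) :
  scales_lebesgue K -> scales_lebesgue L -> scales_lebesgue (K *m L).
Proof.
move=> sK sL c S mS; rewrite -(sL c S mS) -(sK 0 _ (measurable_rV_affine L c mS)).
rewrite det_mulmx normrM muleA mulrC EFinM; congr (_ * lebesgue_rV _)%E.
by apply/seteqP; split => v; rewrite /mkset addr0 mulmxA.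
Qed.

(** Slicing along the first coordinate: the map sends slices to slices, acts on
the slice at x as L followed by a translation that depends on x, and permutes the
slices through x -> a x + c_0. *)
Lemma scales_lebesgue_ublock n (a : R) (b : 'rV[R]_n) (L : 'M[R]_n) :
  a != 0 -> scales_lebesgue L ->
  scales_lebesgue (block_mx a%:M b 0 L : 'M[R]_(1 + n)).
Proof.
move=> a0 sL c S mS; rewrite det_ublock det_scalar1 normrM EFinM.
set T := (X in lebesgue_rV X).
have mT : measurable_rV T by exact: measurable_rV_affine.
rewrite -muleA !lebesgue_rV_sections -ge0_integralZl//; last 2 first.
- exact: measurable_lebesgue_rV_section.
- by move=> x _; exact: lebesgue_rV_ge0.
rewrite -[RHS](integral_affine (lsubmx c 0 0) a0)//; last 2 first.
- exact: measurable_lebesgue_rV_section.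
- by move=> x; exact: lebesgue_rV_ge0.
congr (_ * _)%E; apply: eq_integral => x _ /=.
rewrite -[RHS](sL (x *: b + rsubmx c)); last exact: measurable_rV_section.
congr (_ * lebesgue_rV _)%E.
have E (v : 'rV[R]_n) : row_mx (x : R)%:M v *m block_mx a%:M b 0 L + c =
    row_mx (x * a + lsubmx c 0 0)%:M (v *m L + (x *: b + rsubmx c)).
  rewrite mul_row_block mulmx0 addr0 -scalar_mxM mul_scalar_mx.
  rewrite -[in LHS](hsubmxK c) add_row_mx raddfD/= -mx11_scalar.
  by rewrite addrA [v *m L + _]addrC.
by apply/seteqP; split => v; rewrite /T /mkset E.
Qed.

Lemma scales_lebesgue_transvection n (d : 'cV[R]_n) :
  scales_lebesgue (1%:M : 'M[R]_n) ->
  scales_lebesgue (block_mx 1%:M 0 d 1%:M : 'M[R]_(1 + n)).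
Proof.
move=> s1 c S mS.
have mSc : measurable_rV [set w | S (w + c)].
  have := measurable_rV_affine 1%:M c mS.
  by congr measurable_rV; apply/seteqP; split => v; rewrite /mkset mulmx1.
rewrite det_lblock !det1 mulr1 normr1 mul1e.
rewrite (lebesgue_rV_transvection d mSc).
rewrite -[RHS](scales_lebesgue_ublock 0 (oner_neq0 R) s1 c mS).
rewrite -scalar_mx_block det1 normr1 mul1e; congr (lebesgue_rV _).
by apply/seteqP; split => v; rewrite /mkset mulmx1.
Qed.

Lemma unitmx_lblock_diag (n : nat) (d : 'cV[R]_n) :
  (block_mx 1%:M 0 d 1%:M : 'M[R]_(1 + n)) \in unitmx.
Proof. by rewrite unitmxE det_lblock !det1 mulr1 unitr1. Qed.

(** One step of Gaussian elimination: the entry a at the corner clears the rest of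
its column, so L is a transvection times an upper block triangular matrix whose
diagonal blocks are a and the Schur complement K. *)
Lemma scales_lebesgue_pivot n (L : 'M[R]_(1 + n)) :
  (forall K : 'M[R]_n, K \in unitmx -> scales_lebesgue K) ->
  L \in unitmx -> ulsubmx L 0 0 != 0 -> scales_lebesgue L.
Proof.
move=> IHn uL a0; set a := ulsubmx L 0 0 in a0.
pose d := a^-1 *: dlsubmx L.
pose K := drsubmx L - d *m ursubmx L.
have LE : L = block_mx 1%:M 0 d 1%:M *m block_mx a%:M (ursubmx L) 0 K.
  rewrite mulmx_block !mul1mx !mul0mx ?mulmx0 !addr0.
  rewrite addrC subrK mul_mx_scalar scalerA divff// scale1r.
  by rewrite -mx11_scalar submxK.
have uK : K \in unitmx.
  move: uL; rewrite LE unitmx_mul unitmx_lblock_diag /= unitmxE det_ublock.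
  by rewrite unitrM -unitmxE => /andP[_]; rewrite unitmxE.
rewrite LE; apply: scales_lebesgueM.
  by apply: scales_lebesgue_transvection; apply: IHn; exact: unitmx1.
by apply: scales_lebesgue_ublock => //; exact: IHn.
Qed.

(** Change of variables under an invertible affine map, by induction on the
dimension through Gaussian elimination.  If the corner entry vanishes, adding to
the first row a row with nonzero first entry reduces to the case of a pivot; this
row operation is itself upper block triangular with unit corner. *)
Lemma lebesgue_rV_affine n (L : 'M[R]_n) : L \in unitmx -> scales_lebesgue L.
Proof.
elim: n L => [|n IHn] L uL.
  move=> c S mS; rewrite det_mx00 normr1 mul1e; congr (lebesgue_rV _).
  apply/seteqP; split => v; rewrite /mkset (_ : v *m L + c = v)//;
    by rewrite [LHS]thinmx0 [RHS]thinmx0.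
change 'M[R]_(1 + n) in L.
have [a0|] := eqVneq (ulsubmx L 0 0) 0; last exact: scales_lebesgue_pivot.
have [j dj0] : exists j, dlsubmx L j 0 != 0.
  apply/existsP; apply: contraLR uL; rewrite negb_exists => /forallP d0.
  rewrite -(submxK L) (_ : dlsubmx L = 0); last first.
    by apply/colP => j; have := d0 j; rewrite negbK => /eqP ->; rewrite mxE.
  rewrite [ulsubmx L]mx11_scalar a0 unitmxE (det_ublock (0%:M : 'M[R]_1)) det_scalar1.
  by rewrite mul0r unitr0.
pose T (e : R) : 'M[R]_(1 + n) := block_mx 1%:M (e *: delta_mx 0 j) 0 1%:M.
have uT e : T e \in unitmx by rewrite unitmxE det_ublock !det1 mulr1 unitr1.
have TK : T (-1) *m (T 1 *m L) = L.
  rewrite mulmxA /T mulmx_block !mulmx1 !mul1mx !mulmx0 !mul0mx !addr0 !add0r.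
  by rewrite scale1r scaleN1r subrr -scalar_mx_block mul1mx.
rewrite -TK; apply: scales_lebesgueM.
  by apply: scales_lebesgue_ublock; [exact: oner_neq0|apply: IHn; exact: unitmx1].
apply: scales_lebesgue_pivot => //; first by rewrite unitmx_mul uT.
rewrite -(submxK L) mulmx_block block_mxKul mul1mx scale1r mxE a0 add0r.
by rewrite -rowE mxE.
Qed.

End LebesgueRV.

(** * Volumes of simplices *)

Section Simplex.
Variable R : realType.
Local Notation mR := (measurableTypeR R).

Lemma le_lebesgue_rV n (S T : set 'rV[R]_n) :
  measurable_rV S -> measurable_rV T -> S `<=` T ->
  (lebesgue_rV S <= lebesgue_rV T)%E.
Proof.
move=> mS mT ST; rewrite /lebesgue_rV; have [mu ->] := lebesgue_tuple_measure R n.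
by apply: le_measure; rewrite ?inE// => t; exact: ST.
Qed.

Definition cube n (a : R) : set 'rV[R]_n := [set v | forall i, 0 <= v 0 i <= a].
Arguments cube : clear implicits.

Lemma measurable_coord_itv n (J : 'I_n -> interval R) :
  measurable_rV [set v : 'rV[R]_n | forall i, v 0 i \in J i].
Proof.
rewrite /measurable_rV.
have -> : [set t : n.-tuple mR |
      [set v : 'rV[R]_n | forall i, v 0 i \in J i] (\row_i (tnth t i : R))] =
    \bigcap_(i in [set: 'I_n]) ((fun t : n.-tuple mR => tnth t i) @^-1` [set` J i]).
  apply/seteqP; split => t /= Jt i => [_|]; first by have := Jt i; rewrite mxE.
  by rewrite mxE; exact: Jt.
apply: fin_bigcap_measurable => // i _.
rewrite -[X in measurable X]setTI; apply: measurable_tnth => //.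
Qed.

Lemma measurable_cube n a : measurable_rV (cube n a).
Proof.
have := measurable_coord_itv (fun _ : 'I_n => `[0, a]).
by congr measurable_rV; apply/seteqP; split => v /= Hv i; have := Hv i; rewrite in_itv.
Qed.

(** The slice of the cube at x is a lower-dimensional cube or empty. *)
Lemma lebesgue_cube n (a : R) : 0 <= a -> lebesgue_rV (cube n a) = (a ^+ n)%:E.
Proof.
move=> a0; elim: n => [|n IHn].
  by rewrite /lebesgue_rV /= diracE mem_set// => i; case: i.
rewrite (lebesgue_rV_sections (cube n.+1 a : set 'rV[R]_(1 + n))).
transitivity (\int[@lebesgue_measure R]_x
    ((\1_(`[0, a]%classic : set mR) x)%:E * (a ^+ n)%:E))%E.
  apply: eq_integral => x _; rewrite indicE.
  have E (v : 'rV[R]_n) : cube n.+1 a (row_mx (x : R)%:M v : 'rV_(1 + n)) <->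
      (x : R) \in `[0, a] /\ cube n a v.
    rewrite in_itv /=; split => [Hv|[Hx Hv] i].
      split=> [|i].
        have : 0 <= (row_mx (x : R)%:M v) 0 (lshift n 0) <= a by exact: Hv.
        by rewrite row_mxEl mxE eqxx.
      have : 0 <= (row_mx (x : R)%:M v) 0 (rshift 1 i) <= a by exact: Hv.
      by rewrite row_mxEr.
    change (0 <= (row_mx (x : R)%:M v) 0 (i : 'I_(1 + n)) <= a).
    case: (split_ordP (i : 'I_(1 + n))) => j ->.
      by rewrite row_mxEl ord1 mxE eqxx.
    by rewrite row_mxEr.
  case: (boolP (x \in _)) => [/set_mem|/negP] xa /=.
    rewrite mul1e -IHn; congr (lebesgue_rV _); apply/seteqP; split => v /=.
      by move=> /E[].
    by move=> Hv; apply/E.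
  rewrite mul0e -[RHS](@measure0 _ _ _ (@lebesgue_measure R)).
  have -> : [set v | cube n.+1 a (row_mx (x : R)%:M v : 'rV_(1 + n))] = set0.
    by apply/seteqP; split => v //= /E[xa' _]; apply: xa; rewrite inE.
  rewrite /lebesgue_rV measure0; have [mu ->] := lebesgue_tuple_measure R n.
  by rewrite (_ : [set t | _] = set0) ?measure0//.
rewrite ge0_integralZr//; last 2 first.
- exact/measurable_EFinP/measurable_indic.
- by rewrite lee_fin exprn_ge0.
rewrite integral_indic// setIT /= lebesgue_measure_itv /= lte_fin.
rewrite exprS EFinM; congr (_ * _)%E.
by case: ltgtP a0 => // [_|<-] _; rewrite ?sube0// oppr0 adde0.
Qed.

Definition std_simplex n : set 'rV[R]_n :=
  [set v | (forall i, 0 <= v 0 i) /\ \sum_i v 0 i <= 1].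
Arguments std_simplex : clear implicits.

Lemma measurable_std_simplex n : measurable_rV (std_simplex n).
Proof.
rewrite /measurable_rV.
have -> : [set t : n.-tuple mR | std_simplex n (\row_i (tnth t i : R))] =
    [set t | [set v : 'rV[R]_n | forall i, v 0 i \in `[0, +oo[]
               (\row_i (tnth t i : R))] `&`
    ((fun t : n.-tuple mR => \sum_i (tnth t i : R) : mR) @^-1` `]-oo, 1]%classic).
  have E t : \sum_i (\row_i (tnth t i : R)) 0 i = \sum_(i < n) (tnth t i : R).
    by apply: eq_bigr => i _; rewrite mxE.
  apply/seteqP; split => t; rewrite /setI /preimage /mkset /std_simplex /mkset /= E in_itv /=.
    by move=> [t0 t1]; split => // i; rewrite in_itv /= t0.
  by move=> [t0 t1]; split => // i; have := t0 i; rewrite in_itv /= andbT.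
apply: measurableI; first exact: measurable_coord_itv.
rewrite -[X in measurable X]setTI; apply: measurable_sum => //.
by move=> i; exact: measurable_tnth.
Qed.

Definition std_volume n : R := fine (lebesgue_rV (std_simplex n)).

Lemma std_simplex_sub_cube n : std_simplex n `<=` cube n 1.
Proof.
move=> v [v0 v1] i; rewrite v0 (le_trans _ v1)// (bigD1 i)//= lerDl.
by apply: sumr_ge0.
Qed.

(** The reference simplex lies in the unit cube, hence has finite measure. *)
Lemma lebesgue_std_simplex n :
  lebesgue_rV (std_simplex n) = (std_volume n)%:E.
Proof.
rewrite fineK// ge0_fin_numE ?lebesgue_rV_ge0//.
apply: (@le_lt_trans _ _ (1 ^+ n)%:E); last by rewrite ltry.
rewrite -lebesgue_cube//; apply: le_lebesgue_rV.
- exact: measurable_std_simplex.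
- exact: measurable_cube.
- exact: std_simplex_sub_cube.
Qed.

(** The reference simplex contains the cube of side 1 / (n + 1), a side that also
makes sense when n = 0. *)
Lemma std_volume_gt0 n : 0 < std_volume n.
Proof.
have a0 : 0 < n.+1%:R^-1 :> R by rewrite invr_gt0 ltr0n.
rewrite -lte_fin -lebesgue_std_simplex.
apply: (@lt_le_trans _ _ (n.+1%:R^-1 ^+ n)%:E); first by rewrite lte_fin exprn_gt0.
rewrite -lebesgue_cube; last exact: ltW.
apply: le_lebesgue_rV.
- exact: measurable_cube.
- exact: measurable_std_simplex.
move=> v Hv; split => [i|]; first by case/andP: (Hv i).
apply: (@le_trans _ _ (\sum_(i < n) n.+1%:R^-1)).
  by apply: ler_sum => i _; case/andP: (Hv i).
rewrite sumr_const card_ord -[_ *+ n]mulr_natl ler_pdivrMr ?ltr0n// mul1r.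
by rewrite ler_nat.
Qed.

(** Homogeneous coordinates turn affine combinations into products of matrices, so
that determinants of simplices multiply; see [homogeneous_row_comb]. *)
Definition homogeneous n (X : 'I_n.+1 -> 'rV[R]_n) : 'M[R]_(1 + n) :=
  \matrix_i row_mx 1%:M (X i).

Definition homogeneous_det n (X : 'I_n.+1 -> 'rV[R]_n) : R :=
  \det (homogeneous X).

Definition edges n (X : 'I_n.+1 -> 'rV[R]_n) : 'M[R]_n :=
  \matrix_i (X (lift ord0 i) - X ord0).

(** Subtract the first row from the others. *)
Lemma homogeneous_det_edges n (X : 'I_n.+1 -> 'rV[R]_n) :
  homogeneous_det X = \det (edges X).
Proof.
rewrite /homogeneous_det (_ : homogeneous X =
    (block_mx 1%:M 0 (const_mx 1) 1%:M : 'M[R]_(1 + n)) *m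
    block_mx 1%:M (X ord0) 0 (edges X)); last first.
  rewrite mulmx_block !mul1mx !mul0mx !mulmx1 !addr0.
  apply/row_matrixP => i; rewrite rowK /block_mx.
  case: (split_ordP i) => j ->.
    rewrite rowKu [j]ord1 row_row_mx !row_id.
    by rewrite (_ : lshift n 0 = ord0)//; apply: val_inj.
  rewrite rowKd row_row_mx linearD /= row_mul row_const.
  rewrite (_ : rshift 1 j = lift ord0 j); last exact: val_inj.
  rewrite rowK (_ : const_mx 1 = 1%:M :> 'M[R]_1); last first.
    by apply/matrixP => a b; rewrite !mxE !ord1 eqxx.
  by rewrite mul1mx addrC subrK.
by rewrite det_mulmx det_lblock det_ublock !det1 !mul1r.
Qed.

(** In the affine frame with origin X_0 and axes along the edges at X_0, the
simplex is the reference simplex: the coordinates are the weights of X_1, ...,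
X_n, and the weight of X_0 is what is left. *)
Lemma convex_hull_std n (X : 'I_n.+1 -> 'rV[R]_n) : edges X \in unitmx ->
  convex_hull X =
  [set v | std_simplex n (v *m invmx (edges X) + - (X ord0 *m invmx (edges X)))].
Proof.
move=> uX; apply/seteqP; split => [v [w [w0 w1 ->]]|v].
  rewrite /mkset -mulmxBl.
  have -> : \sum_i w i *: X i - X ord0 = (\row_i w (lift ord0 i)) *m edges X.
    rewrite mulmx_sum_row -[X ord0 in LHS]scale1r -w1 scaler_suml -sumrB.
    rewrite big_ord_recl subrr add0r; apply: eq_bigr => i _.
    by rewrite -scalerBr mxE rowK.
  rewrite mulmxK//; split=> [i|]; first by rewrite mxE.
  rewrite -w1 big_ord_recl; under eq_bigr do rewrite mxE.
  by rewrite lerDr.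
rewrite /mkset -mulmxBl; set u := _ *m _ => -[u0 u1].
exists (fun i => if unlift ord0 i is Some j then u 0 j else 1 - \sum_j u 0 j).
split.
- by move=> i; case: unliftP => [j|] _; rewrite ?subr_ge0.
- rewrite big_ord_recl /= unlift_none; under [X in _ + X]eq_bigr do rewrite liftK.
  by rewrite subrK.
rewrite big_ord_recl /= unlift_none; under [X in _ + X]eq_bigr do rewrite liftK.
have -> : v = u *m edges X + X ord0 by rewrite mulmxKV// subrK.
rewrite mulmx_sum_row (eq_bigr (fun i => u 0 i *: X (lift ord0 i) - u 0 i *: X ord0)).
  rewrite sumrB -scaler_suml scalerBl scale1r.
  by rewrite [LHS]addrC [RHS]addrAC addrA.
by move=> i _; rewrite rowK scalerBr.
Qed.

(** The frame of edges maps the reference simplex onto the simplex and dilates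
volumes by its determinant. *)
Lemma volumeE n (X : 'I_n.+1 -> 'rV[R]_n) : homogeneous_det X != 0 ->
  volume X = `|homogeneous_det X| * std_volume n.
Proof.
rewrite homogeneous_det_edges => dX.
have uX : edges X \in unitmx by rewrite unitmxE unitfE.
have uV : invmx (edges X) \in unitmx by rewrite unitmx_inv.
have := lebesgue_rV_affine uV (- (X ord0 *m invmx (edges X))) (@measurable_std_simplex n).
rewrite -convex_hull_std// lebesgue_std_simplex det_inv normfV /volume.
move: (lebesgue_rV _) (lebesgue_rV_ge0 (convex_hull X)) => l.
have d0 : (0 < `|\det (edges X)|^-1%:E)%E by rewrite lte_fin invr_gt0 normr_gt0.
case: l => [l _ | _ |]//=.
  by rewrite -EFinM => -[<-]; rewrite mulVKf// normr_eq0.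
by rewrite gt0_muley.
Qed.

Lemma homogeneous_row_comb n (A : 'I_n.+1 -> 'rV[R]_n) (w : 'rV[R]_(1 + n)) :
  w *m homogeneous A = row_mx (\sum_i w 0 i)%:M (\sum_i w 0 i *: A i).
Proof.
apply/rowP => k; rewrite mxE; case: (split_ordP k) => j ->.
  rewrite row_mxEl [j]ord1 mxE eqxx mulr1n; apply: eq_bigr => i _.
  by rewrite mxE row_mxEl mxE mulr1.
rewrite row_mxEr summxE; apply: eq_bigr => i _.
by rewrite [homogeneous A _ _]mxE row_mxEr mxE.
Qed.

Lemma homogeneous_det_comb n (A X : 'I_n.+1 -> 'rV[R]_n) (B : 'M[R]_(1 + n)) :
  (forall i, \sum_j B i j = 1) -> (forall i, X i = \sum_j B i j *: A j) ->
  homogeneous_det X = \det B * homogeneous_det A.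
Proof.
move=> B1 XE; rewrite /homogeneous_det -det_mulmx; congr (\det _).
apply/row_matrixP => i; rewrite rowK row_mul homogeneous_row_comb.
congr (row_mx _ _).
  by rewrite -(B1 i); congr (_%:M); apply: eq_bigr => j _; rewrite mxE.
by rewrite XE; apply: eq_bigr => j _; rewrite mxE.
Qed.

Lemma affinely_independent_det n (A : 'I_n.+1 -> 'rV[R]_n) :
  affinely_independent A -> homogeneous_det A != 0.
Proof.
move=> hA; apply/det0P => -[w w0]; rewrite homogeneous_row_comb.
rewrite -(row_mx0 R 1 1 n) => /eq_row_mx[/(congr1 (fun M : 'M[R]_1 => M 0 0))].
rewrite !mxE eqxx mulr1n => s0 sA0.
move/eqP: w0; apply; apply/rowP => i; rewrite mxE; exact: (hA (fun i => w 0 i)).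
Qed.

(** Volumes of simplices inscribed in A are read off their barycentric
coordinates. *)
Lemma volume_comb n (A X : 'I_n.+1 -> 'rV[R]_n) (B : 'M[R]_(1 + n)) :
  affinely_independent A -> \det B != 0 ->
  (forall i, \sum_j B i j = 1) -> (forall i, X i = \sum_j B i j *: A j) ->
  volume X = `|\det B| * volume A.
Proof.
move=> /affinely_independent_det hA dB B1 XE.
have XA := homogeneous_det_comb B1 XE.
rewrite volumeE ?XA ?mulf_neq0// volumeE// normrM mulrA//.
Qed.

Lemma volume_gt0 n (A : 'I_n.+1 -> 'rV[R]_n) : affinely_independent A -> 0 < volume A.
Proof.
move=> /affinely_independent_det hA.
by rewrite volumeE// mulr_gt0 ?std_volume_gt0 ?normr_gt0.
Qed.

End Simplex.

(** * Determinants of the cevian configurations *)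

Section Det.
Variable F : fieldType.

(** The two block eliminations of the bordered matrix with blocks 1, v, u, 1 give
the two sides. *)
Lemma det_1_sub_rank1 n (u : 'cV[F]_n) (v : 'rV[F]_n) :
  \det (1%:M - u *m v) = 1 - (v *m u) 0 0.
Proof.
have E1 : \det (block_mx 1%:M v u 1%:M : 'M[F]_(1 + n)) = \det (1%:M - u *m v).
  rewrite (_ : block_mx _ _ _ _ = (block_mx 1%:M 0 u 1%:M : 'M[F]_(1 + n)) *m
    block_mx 1%:M v 0 (1%:M - u *m v)).
    by rewrite det_mulmx det_lblock det_ublock !det1 !mul1r.
  by rewrite mulmx_block !mul1mx !mul0mx !mulmx1 !addr0 addrC subrK.
have E2 : \det (block_mx 1%:M v u 1%:M : 'M[F]_(1 + n)) = 1 - (v *m u) 0 0.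
  rewrite (_ : block_mx _ _ _ _ = (block_mx 1%:M v 0 1%:M : 'M[F]_(1 + n)) *m
    block_mx (1%:M - v *m u) 0 u 1%:M).
    by rewrite det_mulmx det_lblock det_ublock !det1 !mulr1 mul1r det_mx11 !mxE eqxx.
  by rewrite mulmx_block !mul1mx !mul0mx !mulmx1 !add0r subrK.
by rewrite -E1 E2.
Qed.

Lemma det_ones_sub_1 n :
  \det (const_mx 1 - 1%:M : 'M[F]_n) = (-1) ^+ n * (1 - n%:R).
Proof.
rewrite -[const_mx 1 - _]opprB -scaleN1r detZ; congr (_ * _).
rewrite (_ : const_mx 1 = (const_mx 1 : 'cV[F]_n) *m (const_mx 1 : 'rV[F]_n)); last first.
  by apply/matrixP => i j; rewrite !mxE big_ord1 !mxE mulr1.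
rewrite det_1_sub_rank1; congr (_ - _); rewrite mxE.
by under eq_bigr do rewrite !mxE mulr1; rewrite sumr_const card_ord.
Qed.

(** The coordinate matrix of M, N_1, ..., N_n freed from its diagonal factors: a
row of ones above the rows 1 - e_k. *)
Definition vertex_cevians n : 'M[F]_n.+1 :=
  \matrix_(i, j) if unlift ord0 i is Some k then
    1 - (widen_ord (leqnSn n) k == j)%:R else 1.

(** Subtracting the row of ones from the others leaves rows - e_k, where the last
column has a single nonzero entry, in the row of ones. *)
Lemma det_vertex_cevians n : \det (vertex_cevians n) = 1.
Proof.
pose E : 'M[F]_n.+1 := \matrix_(i, j) if unlift ord0 i is Some k then
    - (widen_ord (leqnSn n) k == j)%:R else 1.
(* Multiplication by T adds the first row to all the others. *)
pose T : 'M[F]_n.+1 := \matrix_(i, j) ((j == ord0)%:R + ((i == j) && (i != ord0))%:R).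
have dT : \det T = 1.
  rewrite det_trig; last first.
    apply/is_trig_mxP => i j ij; rewrite mxE.
    have j0 : (j == ord0) = false by apply/negbTE; rewrite -lt0n (leq_ltn_trans _ ij).
    by rewrite j0 (_ : (i == j) = false) ?addr0//; apply/negbTE; rewrite neq_ltn ij.
  by rewrite big1// => i _; rewrite mxE eqxx /=; case: (i == ord0); rewrite /= ?addr0 ?add0r.
have -> : vertex_cevians n = T *m E.
  apply/matrixP => i j; rewrite !mxE (bigD1 ord0)//= !mxE unlift_none mulr1 eqxx.
  case: unliftP => [k|] ->.
    rewrite (bigD1 (lift ord0 k))//= big1 => [|l /andP[l0 lk]].
      by rewrite !mxE liftK eqxx /= ?andbF ?addr0 ?add0r ?mul1r.
    by rewrite mxE (negbTE l0) eq_sym (negbTE lk) /= addr0 mul0r.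
  rewrite big1 => [|l l0]; first by rewrite eqxx !addr0.
  by rewrite !mxE (negbTE l0) eqxx andbF addr0 mul0r.
rewrite det_mulmx dT mul1r (expand_det_col _ ord_max) (bigD1 ord0)//=.
rewrite big1 => [|i i0].
  (* The sign of the cofactor cancels that of the determinant of the minor -1. *)
  transitivity ((-1) ^+ n * (-1) ^+ n : F); last first.
    by rewrite -exprMn mulrNN mulr1 expr1n.
  rewrite mxE unlift_none mul1r addr0 /cofactor; congr (_ * _).
  rewrite (_ : row' _ _ = - 1%:M); last first.
    apply/matrixP => i j; rewrite !mxE liftK; congr (- _%:R).
    by rewrite -(inj_eq val_inj) /= -(inj_eq val_inj) /= /bump leqNgt ltn_ord.
  by rewrite -scaleN1r detZ det1 mulr1.
case: (unliftP ord0 i) i0 => [k|] -> //; rewrite mxE liftK => _.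
rewrite (_ : (_ == _) = false) ?oppr0 ?mul0r//.
by apply/negbTE; rewrite -(inj_eq val_inj) /= ltn_eqF.
Qed.

Definition cevian_mx n (l : 'I_n.+1 -> F) : 'M[F]_n.+1 :=
  \matrix_(i, j) (l j / (1 - l i) * (i != j)%:R).

(** The numerators l_j factor out of the columns and the denominators 1 - l_i out
of the rows. *)
Lemma det_cevian_mx n (l : 'I_n.+1 -> F) :
  \det (cevian_mx l) = (-1) ^+ n * n%:R * \prod_i (l i / (1 - l i)).
Proof.
rewrite (_ : cevian_mx l = diag_mx (\row_i (1 - l i)^-1) *m
    (const_mx 1 - 1%:M) *m diag_mx (\row_i l i)); last first.
  apply/matrixP => i j; rewrite mul_diag_mx mul_mx_diag !mxE.
  by case: (i == j); rewrite /= ?subrr ?subr0 ?mulr0 ?mul0r// !mulr1 mulrC.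
rewrite !det_mulmx !det_diag det_ones_sub_1 big_split /=.
under eq_bigr do rewrite mxE; under [X in _ * X = _]eq_bigr do rewrite mxE.
by rewrite -natr1 exprS; ring.
Qed.

Definition init_cevian_mx n (l : 'I_n.+1 -> F) : 'M[F]_n.+1 :=
  \matrix_(i, j) if unlift ord0 i is Some k then
    cevian_mx l (widen_ord (leqnSn n) k) j else l j.

Lemma det_init_cevian_mx n (l : 'I_n.+1 -> F) :
  \det (init_cevian_mx l) =
  (\prod_i l i) / \prod_(k < n) (1 - l (widen_ord (leqnSn n) k)).
Proof.
rewrite (_ : init_cevian_mx l = diag_mx (\row_i
      if unlift ord0 i is Some k then (1 - l (widen_ord (leqnSn n) k))^-1 else 1) *m
    vertex_cevians n *m diag_mx (\row_i l i)); last first.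
  apply/matrixP => i j; rewrite mul_diag_mx mul_mx_diag !mxE.
  case: unlift => [k|]; last by rewrite !mul1r.
  rewrite mxE; case: (_ == j); rewrite /= ?subrr ?subr0 ?mulr0 ?mul0r//.
  by rewrite !mulr1 mulrC.
rewrite !det_mulmx !det_diag det_vertex_cevians mulr1.
under [X in _ * X = _]eq_bigr do rewrite mxE.
rewrite mulrC; congr (_ * _); rewrite big_ord_recl mxE unlift_none mul1r -prodfV.
by apply: eq_bigr => k _; rewrite mxE liftK.
Qed.

End Det.

(** * Barycentric coordinates of the cevian simplex *)

Section Cevian.
Variable R : realType.

Lemma barycentric_unique n k (A : 'I_k -> 'rV[R]_n) (u v : 'I_k -> R) :
  affinely_independent A -> \sum_i u i = \sum_i v i ->
  \sum_i u i *: A i = \sum_i v i *: A i -> u =1 v.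
Proof.
move=> hA uv uvA i; apply/eqP; rewrite -subr_eq0; apply/eqP.
apply: (hA (fun i => u i - v i)); first by rewrite sumrB uv subrr.
by under eq_bigr do rewrite scalerBl; rewrite sumrB uvA subrr.
Qed.

(** Two expressions of N_i in barycentric coordinates are compared at the vertex
A_i: on the line A_i M the coordinate is 1 - t + t l_i, in the facet it is 0.
Hence t = 1 / (1 - l_i). *)
Lemma cevian_coords n (A : 'I_n.+1 -> 'rV[R]_n) (l : 'I_n.+1 -> R)
    (N : 'I_n.+1 -> 'rV[R]_n) (M : 'rV[R]_n) :
  affinely_independent A -> barycentric_coords A M l -> cevian_simplex A M N ->
  forall i, \sum_j cevian_mx l i j = 1 /\ N i = \sum_j cevian_mx l i j *: A j.
Proof.
move=> hA [l1 ->] hN i.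
have [[t _ tN] [w [_ w1 wN]]] := hN i.
pose u j := (1 - t) * (j == i)%:R + t * l j.
have sumd (V : lmodType R) (F : 'I_n.+1 -> V) : \sum_j (j == i)%:R *: F j = F i.
  rewrite (bigD1 i)//= eqxx scale1r big1 ?addr0// => j /negbTE ->.
  by rewrite scale0r.
have uE : \sum_j u j *: A j = N i.
  under eq_bigr do rewrite scalerDl -!scalerA.
  rewrite big_split /= -!scaler_sumr sumd -tN scalerBl scale1r scalerBr.
  by rewrite -addrA [- _ + _]addrC.
have u1 : \sum_j u j = 1.
  rewrite big_split /= -!mulr_sumr l1 (bigD1 i)//= eqxx big1 => [|j /negbTE -> //].
  by rewrite addr0 !mulr1 subrK.
have ui : u i = 0.
  (* v collects the coordinates of N_i in the facet, with 0 at the vertex A_i. *)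
  pose v j := if unlift i j is Some k then w k else 0.
  rewrite (@barycentric_unique _ _ A u v)//; first by rewrite /v unlift_none.
    rewrite u1 -w1 (bigD1_ord i)//= /v unlift_none add0r.
    by apply: eq_bigr => k _; rewrite liftK.
  rewrite uE wN (bigD1_ord i)//= /v unlift_none scale0r add0r.
  by apply: eq_bigr => k _; rewrite liftK.
have tl : t * (1 - l i) = 1 by move: ui; rewrite /u eqxx mulr1 => H; lra.
have li0 : 1 - l i != 0.
  by apply/eqP => z; move: tl; rewrite z mulr0 => /eqP; rewrite eq_sym oner_eq0.
have tE : t = (1 - l i)^-1 by rewrite -[LHS](mulfK li0) tl mul1r.
have cE j : cevian_mx l i j = u j.
  rewrite mxE eq_sym /u; have [->|_] := eqVneq j i; last first.
    by rewrite mulr0 add0r mulr1 mulrC tE.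
  by rewrite mulr0 -ui /u eqxx.
split; first by rewrite -u1; apply: eq_bigr => j _; rewrite cE.
by rewrite -uE; apply: eq_bigr => j _; rewrite cE.
Qed.

Lemma init_cevian_coords n (A : 'I_n.+1 -> 'rV[R]_n) (l : 'I_n.+1 -> R)
    (N : 'I_n.+1 -> 'rV[R]_n) (M : 'rV[R]_n) :
  affinely_independent A -> barycentric_coords A M l -> cevian_simplex A M N ->
  forall i, \sum_j init_cevian_mx l i j = 1 /\
    cons_init M N i = \sum_j init_cevian_mx l i j *: A j.
Proof.
move=> hA lM hN i; have NE := cevian_coords hA lM hN.
rewrite /cons_init; case: (unliftP ord0 i) => [k|] ->.
  have [N1 ->] := NE (widen_ord (leqnSn n) k).
  by split; [rewrite -[RHS]N1|]; apply: eq_bigr => j _;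
    rewrite [in LHS]mxE [in RHS]mxE liftK ?mxE.
have [l1 ME] := lM.
by split; [rewrite -[RHS]l1|rewrite [LHS]ME]; apply: eq_bigr => j _; rewrite mxE unlift_none.
Qed.

Lemma cevian_volume_ratio n (A : 'I_n.+1 -> 'rV[R]_n) (l : 'I_n.+1 -> R)
    (N : 'I_n.+1 -> 'rV[R]_n) (M : 'rV[R]_n) :
  (0 < n)%N -> affinely_independent A -> barycentric_coords A M l ->
  (forall i, 0 < l i < 1) -> cevian_simplex A M N ->
  (volume N - volume (cons_init M N)) / volume A =
  \prod_i (l i / (1 - l i)) * (n%:R - 1 + l ord_max).
Proof.
move=> n0 hA lM l01 hN.
have lgt0 i : 0 < l i by case/andP: (l01 i).
have l'gt0 i : 0 < 1 - l i by rewrite subr_gt0; case/andP: (l01 i).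
have p0 : 0 < \prod_i (l i / (1 - l i)).
  by apply: prodr_gt0 => i _; rewrite divr_gt0.
have n0' : 0 < n%:R :> R by rewrite ltr0n.
have dN : `|\det (cevian_mx l)| = n%:R * \prod_i (l i / (1 - l i)).
  by rewrite det_cevian_mx !normrM normr_sign mul1r !gtr0_norm.
have dM : `|\det (init_cevian_mx l)| = (1 - l ord_max) * \prod_i (l i / (1 - l i)).
  rewrite det_init_cevian_mx gtr0_norm; last first.
    by rewrite divr_gt0// prodr_gt0.
  rewrite big_split /= mulrCA; congr (_ * _).
  rewrite [in RHS]prodfV big_ord_recr /= invfM mulrCA divff ?mulr1//.
  by rewrite gt_eqF.
rewrite (@volume_comb _ _ A N (cevian_mx l))//; last 3 first.
- by rewrite -normr_gt0 dN mulr_gt0.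
- by move=> i; have [] := cevian_coords hA lM hN i.
- by move=> i; have [] := cevian_coords hA lM hN i.
rewrite (@volume_comb _ _ A (cons_init M N) (init_cevian_mx l))//; last 3 first.
- by rewrite -normr_gt0 dM mulr_gt0.
- by move=> i; have [] := init_cevian_coords hA lM hN i.
- by move=> i; have [] := init_cevian_coords hA lM hN i.
rewrite -mulrBl mulfK ?gt_eqF ?volume_gt0// dN dM -mulrBl mulrC.
by congr (_ * _); ring.
Qed.

(** If the weight at A_i vanished, moving M slightly away from A_i would make it
negative, although the moved point is still in the simplex. *)
Lemma interior_coords n (A : 'I_n.+1 -> 'rV[R]_n) (M : 'rV[R]_n) :
  affinely_independent A -> interior (convex_hull A) M ->
  exists2 l, barycentric_coords A M l & forall i, 0 < l i.
Proof.
move=> hA hM; have [l [l0 l1 ME]] := interior_subset hM.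
exists l => // i; rewrite lt_neqAle l0 andbT eq_sym; apply/eqP => li0.
have cf : (fun e : R => M + e *: (M - A i)) @ (0 : R) --> M.
  rewrite -[X in _ --> X]addr0 -(scale0r (M - A i)).
  by apply: cvgD; [exact: cvg_cst|apply: cvgZr_tmp; exact: cvg_id].
have /nbhs_ballP[r /= r0 hr] := cf _ hM.
have [|w [w0 w1]] := hr (r / 2).
  by rewrite /ball /= sub0r normrN gtr0_norm ?divr_gt0// ltr_pdivrMr// ltr_pMr// ltr1n.
have : 0 < r / 2 by rewrite divr_gt0.
move: (r / 2) => e e0 wE.
have := w0 i; rewrite (@barycentric_unique _ _ A w (fun j => (1 + e) * l j - e * (j == i)%:R))//.
- by rewrite li0 eqxx mulr0 mulr1 sub0r oppr_ge0 leNgt e0.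
- rewrite w1 sumrB -!mulr_sumr l1 (bigD1 i)//= eqxx big1 => [|j /negbTE -> //].
  by rewrite addr0 !mulr1 addrK.
rewrite -wE; under eq_bigr do rewrite scalerBl -!scalerA.
rewrite sumrB -!scaler_sumr -ME (bigD1 i)//= eqxx scale1r big1 => [|j /negbTE ->]; last first.
  by rewrite scale0r.
by rewrite addr0 scalerDl scale1r scalerBr addrA.
Qed.

End Cevian.

(** * Maximization *)

Section Ineq.
Variable K : realFieldType.

(** Smoothing of a pair at constant sum.  After clearing denominators the difference
of the two sides is (1 - x - y) (a - x) (y - a), which is where x + y < 1 enters:
the logarithm of x / (1 - x) is not concave on (0, 1). *)
Lemma odds_pair (a x y : K) : 0 < x -> x <= a -> a <= y -> x + y < 1 ->
  x / (1 - x) * (y / (1 - y)) <=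
  a / (1 - a) * ((x + y - a) / (1 - (x + y - a))).
Proof.
move=> x0 xa ay xy.
have x1 : 0 < 1 - x by lra.
have y1 : 0 < 1 - y by lra.
have a1 : 0 < 1 - a by lra.
have z1 : 0 < 1 - (x + y - a) by lra.
rewrite !mulf_div ler_pdivrMr ?mulr_gt0// mulrAC ler_pdivlMr ?mulr_gt0//.
rewrite -subr_ge0 (_ : _ - _ = (1 - x - y) * ((a - x) * (y - a))); last by ring.
by rewrite !mulr_ge0//; lra.
Qed.

Lemma le_sum_seq (c : K) (s : seq K) :
  {in s, forall z, c <= z} -> c * (size s)%:R <= \sum_(z <- s) z.
Proof.
move=> cs; rewrite -sum1_size natr_sum mulr_sumr big_seq [leRHS]big_seq.
by apply: ler_sum => z zs; rewrite mulr1 cs.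
Qed.

Lemma sum_seq_le (c : K) (s : seq K) :
  {in s, forall z, z <= c} -> \sum_(z <- s) z <= c * (size s)%:R.
Proof.
move=> cs; rewrite -sum1_size natr_sum mulr_sumr big_seq [leRHS]big_seq.
by apply: ler_sum => z zs; rewrite mulr1 cs.
Qed.

(** Induction on the number of terms: smoothing the least and the greatest term
makes one of them equal to the mean a, and the remaining ones still have mean
a. *)
Lemma prod_odds_le (a : K) (s : seq K) :
  {in s, forall x, 0 < x} -> \sum_(x <- s) x = a * (size s)%:R ->
  \sum_(x <- s) x < 1 ->
  \prod_(x <- s) (x / (1 - x)) <= (a / (1 - a)) ^+ size s.
Proof.
move: {2}(size s) (erefl (size s)) => k; elim: k s => [|k IHk] s sk s0 sa s1.
  by rewrite sk (size0nil sk) big_nil expr0.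
case: k IHk sk => [_|k IHk] sk.
  case: s sk sa {s0 s1} => [|x []]//= _; rewrite !big_seq1 mulr1 => ->.
  by rewrite expr1.
have ps : perm_eq (sort <=%R s) s by rewrite perm_sort.
rewrite -(perm_big _ ps) /= -(perm_size ps).
rewrite -(perm_big _ ps) /= in sa s1.
rewrite -(perm_size ps) in sk sa.
have {s0} : {in sort <=%R s, forall x, 0 < x} by move=> x; rewrite mem_sort; exact: s0.
have : sorted <=%R (sort <=%R s) by apply: sort_sorted; exact: le_total.
rewrite sorted_pairwise; last exact: le_trans.
move: (sort _ s) sk sa s1 => {ps s} [//|x s].
case/lastP: s => [//|s y]; rewrite /= size_rcons => -[sk] sa s1.
rewrite pairwise_rcons all_rcons => /andP[/andP[xy /allP xs] /andP[/allP sy _]] s0.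
rewrite !big_cons !(perm_big _ (permEl (perm_rcons y s))) !big_cons /= sk in sa s1 *.
have x0 : 0 < x by apply: s0; rewrite mem_head.
have sge := le_sum_seq xs; have sle := sum_seq_le sy.
rewrite sk in sge sle.
have k1 : 0 < k.+2%:R :> K by rewrite ltr0n.
have xa : x <= a by rewrite -(ler_pM2r k1) -sa -!natr1; lra.
have ay : a <= y by rewrite -(ler_pM2r k1) -sa -!natr1; lra.
(* This gives x + y < 1. *)
have rest0 : 0 <= \sum_(z <- s) z.
  by rewrite big_seq; apply: sumr_ge0 => z zs; rewrite (le_trans (ltW x0))// xs.
have s'0 : {in s, forall z, 0 < z} by move=> z zs; rewrite (lt_le_trans x0)// xs.
have a0 : 0 < a by lra.
have z0 : 0 < x + y - a by lra.
have a1 : 0 < 1 - a by lra.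
have xy1 : x + y < 1 by lra.
have s'1 : x + y - a + \sum_(z <- s) z < 1 by lra.
have s'a : x + y - a + \sum_(z <- s) z = a * k.+1%:R.
  by move: sa; rewrite -[k.+2%:R]natr1; lra.
have := IHk (x + y - a :: s); rewrite /= sk !big_cons => /(_ erefl) IH.
rewrite mulrA exprS.
apply: le_trans (ler_wpM2r _ (odds_pair x0 xa ay _)) _; last 1 first.
- rewrite -[leLHS]mulrA ler_pM2l ?divr_gt0//.
  by apply: IH => // z; rewrite inE => /orP[/eqP ->|/s'0].
- rewrite big_seq; apply: prodr_ge0 => z zs.
  have z1 : z <= \sum_(z <- s) z.
    rewrite (big_rem z zs) /= lerDl big_seq; apply: sumr_ge0 => w ws.
    by rewrite ltW// s'0// (mem_rem ws).
  by rewrite divr_ge0 ?(ltW (s'0 _ zs))// subr_ge0 (le_trans z1)//; lra.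
- by [].
Qed.

Lemma bernoulli_ge (r : K) m : 0 <= r -> 1 + m%:R * (r - 1) <= r ^+ m.
Proof.
move=> r0; elim: m => [|m IHm]; first by rewrite mul0r addr0 expr0.
rewrite exprS; apply: le_trans (ler_wpM2l r0 IHm).
rewrite -subr_ge0 -natr1 (_ : _ - _ = m%:R * (r - 1) ^+ 2); last by ring.
by rewrite mulr_ge0 ?ler0n// sqr_ge0.
Qed.

(** The hypothesis relating c and m says that c is a critical point of the logarithm
of f(t) = t u(t)^m, where u(t) = (1 - t) / (m + t).  Since 1 / u is convex in t,
the Bernoulli lower bound 1 + m (u(c) / u(t) - 1) of (u(c) / u(t))^m is convex in
t, and at c it has the same value and slope as t / c.  So it stays above t / c,
which says that f(t) <= f(c). *)
Lemma one_var_max (t c : K) m : (0 < m)%N -> 0 < t < 1 -> 0 < c < 1 ->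
  m%:R * (m%:R + 1) * c = (1 - c) * (m%:R + c) ->
  t * ((1 - t) / (m%:R + t)) ^+ m <= c * ((1 - c) / (m%:R + c)) ^+ m.
Proof.
move=> m_gt0 /andP[t0 t1] /andP[c0 c1] crit.
have m0 : 0 < m%:R :> K by rewrite ltr0n.
have mt0 : 0 < m%:R + t by lra.
have mc0 : 0 < m%:R + c by lra.
have t'0 : 0 < 1 - t by lra.
have c'0 : 0 < 1 - c by lra.
set u := (1 - t) / _; set v := (1 - c) / _.
have u0 : 0 < u by rewrite divr_gt0.
have v0 : 0 < v by rewrite divr_gt0.
have tangent : t / c <= 1 + m%:R * (v / u - 1).
  have mE : m%:R * (m%:R + 1) = (1 - c) * (m%:R + c) / c :> K.
    by rewrite -crit mulfK ?gt_eqF.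
  have uvE : v / u - 1 = (m%:R + 1) * ((t - c) / ((m%:R + c) * (1 - t))).
    by rewrite /u /v; field; rewrite !gt_eqF.
  rewrite -subr_ge0 uvE [m%:R * (_ * _)]mulrA mE (_ : _ - _ = (t - c) ^+ 2 / (c * (1 - t))).
    by rewrite divr_ge0 ?sqr_ge0// mulr_ge0 ?ltW.
  by field; rewrite !gt_eqF.
have := le_trans tangent (bernoulli_ge m (ltW (divr_gt0 v0 u0))).
rewrite expr_div_n ler_pdivrMr// mulrAC ler_pdivlMr ?exprn_gt0//.
by rewrite [_ * c]mulrC.
Qed.

End Ineq.

(** omega_n is the smaller root of n x^2 - n^2 x + n - 1; rewritten in t = 1 - n x,
the equation is the criticality condition of [one_var_max] for m = n - 1.  That t
lies in (0, 1) amounts to n^2 - 2 < sqrt(n^4 - 4 n^2 + 4 n) < n^2. *)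
Lemma omega_critical (R : realType) (n : nat) (t := 1 - n%:R * omega R n) :
  (2 <= n)%N ->
  0 < t < 1 /\ (n%:R - 1) * n%:R * t = (1 - t) * (n%:R - 1 + t).
Proof.
move=> hn; have n2 : 2 <= n%:R :> R by rewrite ler_nat.
pose D : R := n%:R ^+ 4 - 4 * n%:R ^+ 2 + 4 * n%:R.
have DE : D = (n%:R ^+ 2 - 2) ^+ 2 + 4 * (n%:R - 1) by rewrite /D; ring.
have D0 : 0 <= D by rewrite DE addr_ge0 ?sqr_ge0//; lra.
have s0 := sqrtr_ge0 D; have s2 := sqr_sqrtr D0.
have tE : t = (2 - n%:R ^+ 2 + Num.sqrt D) / 2.
  by rewrite /t /omega -/D; field; rewrite gt_eqF//; lra.
have s_gt : n%:R ^+ 2 - 2 < Num.sqrt D.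
  rewrite -ltr_sqr ?nnegrE//; last by nra.
  by rewrite s2 DE; lra.
have s_lt : Num.sqrt D < n%:R ^+ 2.
  rewrite -ltr_sqr ?nnegrE ?sqr_ge0// s2 /D; nra.
split; first by rewrite tE; lra.
by rewrite tE; move: s2; rewrite /D; move: (Num.sqrt _) => s s2; nra.
Qed.

(** The value of the volume ratio when all coordinates but the last are equal. *)
Lemma odds_equal_coords (K : realFieldType) n (t : K) : (0 < n)%N -> 0 < t < 1 ->
  ((1 - t) / n%:R / (1 - (1 - t) / n%:R)) ^+ n * (t / (1 - t)) * (n%:R - 1 + t) =
  t * ((1 - t) / (n%:R - 1 + t)) ^+ (n - 1).
Proof.
move=> n0 /andP[t0 t1]; have n1 : 1 <= n%:R :> K by rewrite ler1n.
have -> : (1 - t) / n%:R / (1 - (1 - t) / n%:R) = (1 - t) / (n%:R - 1 + t).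
  by field; rewrite !gt_eqF//; lra.
rewrite -[X in _ ^+ X](subnK n0) addn1 exprSr; move: (_ ^+ (n - 1)) => p.
by field; rewrite !gt_eqF//; lra.
Qed.

Lemma cevian_product_le (R : realFieldType) n (l : 'I_n.+1 -> R) :
  (0 < n)%N -> (forall i, 0 < l i) -> \sum_i l i = 1 ->
  \prod_i (l i / (1 - l i)) * (n%:R - 1 + l ord_max) <=
  l ord_max * ((1 - l ord_max) / (n%:R - 1 + l ord_max)) ^+ (n - 1).
Proof.
move=> n0 l0; rewrite !big_ord_recr /=; set t := l ord_max => l1.
have t0 : 0 < t := l0 ord_max.
have n1 : 1 <= n%:R :> R by rewrite ler1n.
have nn0 : n%:R != 0 :> R by rewrite gt_eqF//; lra.
pose s := [seq l (widen_ord (leqnSn n) i) | i <- enum 'I_n].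
have szs : size s = n by rewrite size_map size_enum_ord.
have sE : \sum_(x <- s) x = 1 - t by rewrite big_map big_enum /= -l1 addrK.
have s0 : {in s, forall x, 0 < x} by move=> x /mapP[i _ ->].
have t1 : t < 1.
  rewrite -subr_gt0 -sE big_map big_enum /=.
  rewrite (bigD1 (Ordinal n0))//= ltr_pwDl// sumr_ge0// => i _.
  exact: ltW.
have := @prod_odds_le _ ((1 - t) / n%:R) s s0.
rewrite szs divfK// sE => /(_ erefl); rewrite gtrBl => /(_ t0).
rewrite big_map big_enum /= => sle.
rewrite -(odds_equal_coords n0) ?t0//.
rewrite ler_wpM2r//; first by lra.
by rewrite ler_wpM2r// divr_ge0//; lra.
Qed.

Unset Implicit Arguments.

Theorem theorem3 (R : realType) (n : nat) (hn : (2 <= n)%N)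
    (A : 'I_n.+1 -> 'rV[R]_n) (hA : affinely_independent A)
    (M : 'rV[R]_n) (hM : interior (convex_hull A) M)
    (N : 'I_n.+1 -> 'rV[R]_n) (hN : cevian_simplex A M N) :
  let ratio := (volume N - volume (cons_init M N)) / volume A in
  let bound := (n%:R - 1) ^+ (n - 1) * (1 - n%:R * omega R n)
               / (n%:R ^+ 2 - n%:R + 1 - n%:R * omega R n) ^+ (n - 1) in
  ratio <= bound /\
  (barycentric_coords A M
     (fun i => if i == ord_max then 1 - n%:R * omega R n else omega R n) ->
   ratio = bound).
Proof.
move=> ratio bound.
have n0 : (0 < n)%N by apply: leq_trans hn.
have n2 : 2 <= n%:R :> R by rewrite ler_nat.
have [l lM l0] := interior_coords hA hM; have [l1 _] := lM.
have l01 i : 0 < l i < 1.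
  rewrite l0 /= -l1 (bigD1_ord i)//= ltrDl (bigD1 (Ordinal n0))//=.
  by rewrite ltr_pwDl// sumr_ge0// => j _; exact: ltW.
have ratioE : ratio = \prod_i (l i / (1 - l i)) * (n%:R - 1 + l ord_max).
  exact: cevian_volume_ratio.
have [c01 crit] := omega_critical R hn.
set c := 1 - n%:R * omega R n in c01 crit.
have /andP[c0 c1] := c01.
have nm0 : 0 < (n%:R - 1) * n%:R :> R by rewrite mulr_gt0; lra.
(* The bound of the statement is the critical value: the condition crit makes the
   fraction (1 - c) / (n - 1 + c) equal to (n - 1) / (n^2 - n + c). *)
have boundE : bound = c * ((1 - c) / (n%:R - 1 + c)) ^+ (n - 1).
  have -> : (1 - c) / (n%:R - 1 + c) = (n%:R - 1) / (n%:R ^+ 2 - n%:R + c).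
    have d1 : n%:R - 1 + c != 0 by rewrite gt_eqF//; lra.
    have d2 : n%:R ^+ 2 - n%:R + c != 0 by rewrite gt_eqF//; lra.
    by apply/eqP; rewrite eqr_div//; apply/eqP; lra.
  rewrite /bound -[_ + 1 - _]addrA -/c expr_div_n.
  by rewrite mulrCA mulrA.
have nB : n%:R - 1 = (n - 1)%:R :> R by rewrite natrB.
split.
  rewrite ratioE boundE; apply: le_trans (cevian_product_le n0 l0 l1) _.
  rewrite nB; apply: one_var_max => //; first by rewrite subn_gt0.
  by rewrite -nB subrK.
case=> [u1 uM].
have lE := barycentric_unique hA (etrans l1 (esym u1)) (etrans (esym (proj2 lM)) uM).
rewrite ratioE boundE lE eqxx -/c -(odds_equal_coords n0 c01).
rewrite big_ord_recr /= lE eqxx; congr (_ * _ * _).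
rewrite (eq_bigr (fun=> (1 - c) / n%:R / (1 - (1 - c) / n%:R))) => [|i _].
  by rewrite prodr_const card_ord.
have -> : l (widen_ord (leqnSn n) i) = (1 - c) / n%:R.
  rewrite lE ifF; last by apply/negbTE; rewrite -(inj_eq val_inj) /= ltn_eqF.
  by rewrite /c; field; rewrite gt_eqF//; lra.
by [].
Qed.
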